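(* The $12\times 12$ two-chunk cyclic matrix $D_{6,2}\left(\frac{7}{3},\frac{29}{15},3,\frac{7}{6}\right)$ is a distance matrix, the twelve-point metric space $X$ it generates is balanced, and $$\lim_{t\to0^+}\mathrm{Mag}(tX)=\frac{44}{59}<1.$$
   Context: Magnitude: for a finite metric space $(X,d)$ with $X=\{x_1,\dots,x_m\}$, the zeta matrix is $Z_X=(e^{-d(x_i,x_j)})_{1\le i,j\le m}$. A weighting is a vector $w\in\mathbb{R}^m$ with $Z_Xw=(1,\dots,1)^T$. If a weighting exists, the magnitude is $\mathrm{Mag}(X)=\sum_{i=1}^m w_i$ for any weighting $w$ (independent of the choice, since $Z_X$ is symmetric); it is not required that $Z_X$ be invertible. For $t>0$, $tX$ denotes the metric space $(X,td)$. A limit as $t\to0^+$ of $\mathrm{Mag}(tX)$ refers to $\mathrm{Mag}(tX)$ being defined for all sufficiently small $t>0$. A distance matrix is a real symmetric matrix with zero diagonal, strictly positive off-diagonal entries, and entries satisfying all triangle inequalities $D_{ij}\le D_{i\ell}+D_{\ell j}$; it generates a finite metric space on its index set. Two-chunk cyclic spaces: for integers $n\ge 2$, $1\le k\le\lfloor n/2\rfloor$ and reals $\alpha,\beta,\gamma,\delta>0$, the $(n,k;\alpha,\beta,\gamma,\delta)$-two-chunk cyclic matrix $D_{n,k}(\alpha,\beta,\gamma,\delta)$ is the symmetric $2n\times 2n$ matrix indexed by $\{a_0,\dots,a_{n-1}\}\sqcup\{b_0,\dots,b_{n-1}\}$ with $D(a_i,a_i)=D(b_i,b_i)=0$, $D(a_i,a_j)=\alpha$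 and $D(b_i,b_j)=\beta$ for $i\ne j$, and $D(a_i,b_j)=D(b_j,a_i)=\gamma$ if $j\equiv i+s\pmod n$ for some $s\in\{0,1,\dots,k-1\}$, and $=\delta$ otherwise. When this matrix is a distance matrix, the metric space it generates is called an $(n,k;\alpha,\beta,\gamma,\delta)$-two-chunk cyclic metric space and is denoted $X_{n,k}(\alpha,\beta,\gamma,\delta)$. Balanced condition: such a space is called balanced if $2\bigl(k\gamma+(n-k)\delta\bigr)=(n-1)(\alpha+\beta)$. *)

(* Defs.v *)
From HB Require Import structures.
From mathcomp Require Import all_boot all_order all_algebra.
From mathcomp Require Import all_classical all_reals all_analysis.

Set Implicit Arguments.
Unset Strict Implicit.
Unset Printing Implicit Defensive.

Import Order.TTheory GRing.Theory Num.Theory.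
Import numFieldNormedType.Exports.

Local Open Scope classical_set_scope.
Local Open Scope ring_scope.

(* A finite metric space with m points is given by its distance matrix; the
   rescaled space tX is then given by [t *: D]. *)
Definition distance_matrix (R : realType) (m : nat) (D : 'M[R]_m) : Prop :=
  [/\ D^T = D,
      forall i, D i i = 0,
      forall i j, i != j -> 0 < D i j &
      forall i j l, D i j <= D i l + D l j].

Definition zeta_mx (R : realType) (m : nat) (D : 'M[R]_m) : 'M[R]_m :=
  \matrix_(i, j) expR (- D i j).

Definition weightings (R : realType) (m : nat) (D : 'M[R]_m) : set 'cV[R]_m :=
  [set w | zeta_mx D *m w = const_mx 1].

Definition has_magnitude (R : realType) (m : nat) (D : 'M[R]_m) : Prop :=
  weightings D !=set0.

(* The sum of the entries of some weighting. For symmetric D the choice of the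
   weighting is irrelevant ([magnitudeE]). The value is meaningless unless
   [has_magnitude D] holds. *)
Definition magnitude (R : realType) (m : nat) (D : 'M[R]_m) : R :=
  \sum_i (xget 0 (weightings D)) i 0.

Lemma magnitudeE (R : realType) (m : nat) (D : 'M[R]_m) (w : 'cV[R]_m) :
  D^T = D -> weightings D w -> magnitude D = \sum_i w i 0.
Proof.
move=> symD Dw; rewrite /magnitude.
have Dv : weightings D (xget 0 (weightings D)) by exact: (xgetI 0 Dw).
move: (xget _ _) Dv => v Dv.
have symZ : (zeta_mx D)^T = zeta_mx D.
  by apply/matrixP => i j; rewrite !mxE -{1}symD mxE.
have sumE (u : 'cV[R]_m) : \sum_i u i 0 = ((const_mx 1 : 'cV_m)^T *m u) 0 0.
  by rewrite mxE; apply: eq_bigr => i _; rewrite !mxE mul1r.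
have -> : \sum_i w i 0 = (w^T *m (const_mx 1 : 'cV_m)) 0 0.
  by rewrite mxE; apply: eq_bigr => i _; rewrite !mxE mulr1.
by rewrite -Dv mulmxA sumE -Dw trmx_mul symZ.
Qed.

Definition chunk_mx (R : realType) (n : nat) (c : R) : 'M[R]_n :=
  \matrix_(i, j) if i == j then 0 else c.

Definition cross_mx (R : realType) (n k : nat) (gamma delta : R) : 'M[R]_n :=
  \matrix_(i, j)
    if [exists s : 'I_k, j == i + s %[mod n]]%N then gamma else delta.

(* Row/column [lshift n i] is the point a_i and [rshift n j] is b_j. Meant for
   2 <= n, 1 <= k <= n./2 and positive alpha, beta, gamma, delta. *)
Definition two_chunk_mx (R : realType) (n k : nat)
    (alpha beta gamma delta : R) : 'M[R]_(n + n) :=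
  block_mx (chunk_mx n alpha) (cross_mx n k gamma delta)
           (cross_mx n k gamma delta)^T (chunk_mx n beta).

Definition balanced (R : realType) (n k : nat)
    (alpha beta gamma delta : R) : Prop :=
  2 * (k%:R * gamma + (n%:R - k%:R) * delta) = (n%:R - 1) * (alpha + beta).

(* Main.v *)
Require Import Defs.
From mathcomp Require Import all_boot all_order all_algebra.
From mathcomp Require Import all_classical all_reals all_analysis.
From mathcomp Require Import ring lra.
Import Order.TTheory GRing.Theory Num.Theory.
Import numFieldNormedType.Exports.
Local Open Scope classical_set_scope.
Local Open Scope ring_scope.

(** The zeta matrix of a two-chunk cyclic space has four blocks, each of constant
    row and column sums: A within the first chunk, B within the second one and
    C across. A vector that is constant on each chunk is therefore a weighting
    as soon as it solves a 2 x 2 linear system, which gives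
    [[
      Mag = n (A + B - 2 C) / (A B - C^2)
    ]]
    whenever A B <> C^2 ([two_chunk_magnitude]).

    After rescaling by t, the sums A, B and C all tend to n as t tends to 0, so
    numerator and denominator both vanish in the limit. Balance says exactly
    that the terms of order t of A + B - 2 C cancel, so that this factor is
    t^2 sigma / 2 up to higher order, with sigma a quadratic expression in the
    distances. Writing
    [[
      A B - C^2 = C (A + B - 2 C) + (A - C) (B - C),
    ]]
    where A - C and B - C are - mu t and mu t up to higher order, one sees that
    the denominator is of order t^2 too, and the quotient tends to
    n sigma / (n sigma - 2 mu^2) ([two_chunk_small_scale]). A limit other than 1
    is thus due to mu <> 0, that is, by balance, to a difference between the
    distances within the two chunks. For the twelve points at hand mu = 1 and
    sigma = - 44/45, hence the value 44/59. *)

Set Implicit Arguments.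
Unset Strict Implicit.
Unset Printing Implicit Defensive.

(** * Row and column sums of the blocks *)

Lemma card_cyclic_row (n k : nat) (i : 'I_n) : (k <= n)%N ->
  #|[pred j : 'I_n | [exists s : 'I_k, j == i + s %[mod n]]%N]| = k.
Proof.
move=> kn; have n0 : (0 < n)%N by apply: leq_ltn_trans (ltn_ord i).
pose f (s : 'I_k) := Ordinal (ltn_pmod (i + s) n0).
have injf : injective f.
  move=> s s' /(congr1 val)/eqP; rewrite /= eqn_modDl.
  have lt_n (r : 'I_k) : (r < n)%N := leq_trans (ltn_ord r) kn.
  by rewrite !modn_small // => /eqP /val_inj.
rewrite -[RHS]card_ord -(fintype.card_image injf); apply: eq_card => j; rewrite !inE.
apply/existsP/fintype.imageP => [[s /eqP js]|[s _ ->]]; exists s => //.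
  by apply: val_inj; rewrite /= -js modn_small.
by rewrite /= modn_mod.
Qed.

(** The index i is determined by the shift s as j - s modulo n, written with
    n - s to stay within the natural numbers. *)
Lemma card_cyclic_col (n k : nat) (j : 'I_n) : (k <= n)%N ->
  #|[pred i : 'I_n | [exists s : 'I_k, j == i + s %[mod n]]%N]| = k.
Proof.
move=> kn; have n0 : (0 < n)%N by apply: leq_ltn_trans (ltn_ord j).
have lt_n (r : 'I_k) : (r < n)%N := leq_trans (ltn_ord r) kn.
pose f (s : 'I_k) := Ordinal (ltn_pmod (j + (n - s)) n0).
have fK (s : 'I_k) : (f s + s = j %[mod n])%N.
  by rewrite /= modnDml -addnA subnK ?modnDr // ltnW.
have injf : injective f.
  move=> s s' /= ff'; have /eqP := fK s; rewrite ff' -(fK s') eqn_modDl.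
  by rewrite !modn_small // => /eqP /val_inj.
rewrite -[RHS]card_ord -(fintype.card_image injf); apply: eq_card => i; rewrite !inE.
apply/existsP/fintype.imageP => [[s /eqP js]|[s _ ->]]; exists s => //.
  have /eqP := fK s; rewrite js eqn_modDr !modn_small // => /eqP fi.
  exact: val_inj.
by rewrite fK.
Qed.

Lemma sum_if_card (R : realType) (n : nat) (P : pred 'I_n) (x y : R) :
  \sum_i (if P i then x else y) = #|P|%:R * x + (n%:R - #|P|%:R) * y.
Proof.
rewrite (bigID P) /= (eq_bigr (fun=> x)) => [|i ->//].
rewrite [X in _ + X](eq_bigr (fun=> y)) => [|i /negbTE ->//].
rewrite !sumr_const !mulr_natl; congr (_ + _).
have -> : n%:R = #|P|%:R + #|[predC P]|%:R :> R.
  by rewrite -natrD cardC card_ord.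
by rewrite addrAC subrr add0r mulr_natl.
Qed.

(** The common row sums of the diagonal and off-diagonal blocks of the zeta
    matrix. *)
Definition chunk_sum (R : realType) (n : nat) (c : R) : R :=
  1 + (n%:R - 1) * expR (- c).

Definition cross_sum (R : realType) (n k : nat) (gamma delta : R) : R :=
  k%:R * expR (- gamma) + (n%:R - k%:R) * expR (- delta).

Lemma sum_chunk_mx (R : realType) (n : nat) (c : R) (i : 'I_n) :
  \sum_j expR (- chunk_mx n c i j) = chunk_sum n c.
Proof.
rewrite -[RHS](_ : #|pred1 i|%:R * 1 + (n%:R - #|pred1 i|%:R) * expR (- c) = _).
  rewrite -sum_if_card; apply: eq_bigr => j _; rewrite mxE /= eq_sym.
  by case: eqP => // _; rewrite oppr0 expR0.
by rewrite card1 mulr1.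
Qed.

Lemma sum_cross_mx_row (R : realType) (n k : nat) (c d : R) (i : 'I_n) :
  (k <= n)%N -> \sum_j expR (- cross_mx n k c d i j) = cross_sum n k c d.
Proof.
move=> kn; rewrite /cross_sum -[in RHS](card_cyclic_row i kn) -sum_if_card.
by apply: eq_bigr => j _; rewrite mxE /=; case: ifP.
Qed.

Lemma sum_cross_mx_col (R : realType) (n k : nat) (c d : R) (j : 'I_n) :
  (k <= n)%N -> \sum_i expR (- cross_mx n k c d i j) = cross_sum n k c d.
Proof.
move=> kn; rewrite /cross_sum -[in RHS](card_cyclic_col j kn) -sum_if_card.
by apply: eq_bigr => i _; rewrite mxE /=; case: ifP.
Qed.

(** * The metric *)

Lemma scale_two_chunk_mx (R : realType) (n k : nat) (a b c d t : R) :
  t *: two_chunk_mx n k a b c d = two_chunk_mx n k (t * a) (t * b) (t * c) (t * d).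
Proof.
rewrite /two_chunk_mx scale_block_mx; congr block_mx;
  apply/matrixP => i j; rewrite !mxE; case: ifP => // _; exact: mulr0.
Qed.

Lemma tr_two_chunk_mx (R : realType) (n k : nat) (a b c d : R) :
  (two_chunk_mx n k a b c d)^T = two_chunk_mx n k a b c d.
Proof.
rewrite /two_chunk_mx tr_block_mx trmxK; congr block_mx;
  by apply/matrixP => i j; rewrite !mxE eq_sym.
Qed.

(** The triangles of distinct points have sides (a, a, a), (b, b, b), or two
    cross distances together with one a or b. The hypotheses cover the
    latter kind, the two cross distances being equal or not. *)
Lemma two_chunk_distance (R : realType) (n k : nat) (a b c d : R) :
    0 < a -> 0 < b -> 0 < c -> 0 < d ->
    a <= 2 * c -> a <= 2 * d -> b <= 2 * c -> b <= 2 * d ->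
    `|c - d| <= a -> `|c - d| <= b ->
  distance_matrix (two_chunk_mx n k a b c d).
Proof.
rewrite !ler_norml => a0 b0 c0 d0 a2c a2d b2c b2d /andP[cda cda'] /andP[cdb cdb'].
split; first exact: tr_two_chunk_mx.
- by move=> i; rewrite -(fintype.splitK i); case: (fintype.split i) => {}i;
    rewrite ?block_mxEul ?block_mxEdr mxE eqxx.
- move=> i j; rewrite -(fintype.splitK i) -(fintype.splitK j).
  case: (fintype.split i) (fintype.split j) => {}i [] {}j /=;
    rewrite ?block_mxEul ?block_mxEur ?block_mxEdl ?block_mxEdr !mxE.
  + by rewrite (inj_eq (@lshift_inj _ _)) => /negbTE ->.
  + by move=> _; case: ifP.
  + by move=> _; case: ifP.
  + by rewrite (inj_eq (@rshift_inj _ _)) => /negbTE ->.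
- move=> i j l; rewrite -(fintype.splitK i) -(fintype.splitK j) -(fintype.splitK l).
  case: (fintype.split i) (fintype.split j) (fintype.split l) => {}i [] {}j [] {}l /=;
    rewrite ?block_mxEul ?block_mxEur ?block_mxEdl ?block_mxEdr !mxE.
  + case: (eqVneq i l) => [->|_]; first by rewrite add0r.
    by do 2 case: ifP => _; lra.
  + by do 3 case: ifP => _; lra.
  + case: (eqVneq i l) => [->|_]; first by rewrite add0r.
    by do 2 case: ifP => _; lra.
  + case: (eqVneq l j) => [->|_]; first by rewrite addr0.
    by do 2 case: ifP => _; lra.
  + case: (eqVneq l j) => [->|_]; first by rewrite addr0.
    by do 2 case: ifP => _; lra.
  + case: (eqVneq i l) => [->|_]; first by rewrite add0r.
    by do 2 case: ifP => _; lra.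
  + by do 3 case: ifP => _; lra.
  + case: (eqVneq i l) => [->|_]; first by rewrite add0r.
    by do 2 case: ifP => _; lra.
Qed.

(** * Magnitude *)

(** By constancy of the row and column sums, the weighting equation for a vector
    equal to u on the first chunk and v on the second one reduces to
    A u + C v = 1 and C u + B v = 1; the entries are given by Cramer's rule. *)
Lemma two_chunk_weighting (R : realType) (n k : nat) (a b c d : R) :
    (k <= n)%N ->
  let A := chunk_sum n a in let B := chunk_sum n b in
  let C := cross_sum n k c d in A * B - C ^+ 2 != 0 ->
  weightings (two_chunk_mx n k a b c d)
    (col_mx (const_mx ((B - C) / (A * B - C ^+ 2)))
            (const_mx ((A - C) / (A * B - C ^+ 2)))).
Proof.
move=> kn A B C nz; apply/matrixP => i j; rewrite !mxE big_split_ord /=.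
under eq_bigr do rewrite col_mxEu [zeta_mx _ _ _]mxE [const_mx _ _ _]mxE /two_chunk_mx.
under [X in _ + X]eq_bigr do
  rewrite col_mxEd [zeta_mx _ _ _]mxE [const_mx _ _ _]mxE /two_chunk_mx.
rewrite -!mulr_suml -(fintype.splitK i); case: (fintype.split i) => {}i /=.
  under eq_bigr do rewrite block_mxEul.
  under [X in _ + X * _]eq_bigr do rewrite block_mxEur.
  rewrite sum_chunk_mx (sum_cross_mx_row c d i kn) -/A -/C.
  by clearbody A B C; field.
under eq_bigr do rewrite block_mxEdl mxE.
under [X in _ + X * _]eq_bigr do rewrite block_mxEdr.
rewrite (sum_cross_mx_col c d i kn) sum_chunk_mx -/B -/C.
by clearbody A B C; field.
Qed.

Lemma two_chunk_magnitude (R : realType) (n k : nat) (a b c d : R) :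
    (k <= n)%N ->
  let A := chunk_sum n a in let B := chunk_sum n b in
  let C := cross_sum n k c d in A * B - C ^+ 2 != 0 ->
  magnitude (two_chunk_mx n k a b c d) =
    n%:R * (A + B - 2 * C) / (A * B - C ^+ 2).
Proof.
move=> kn A B C nz.
rewrite (magnitudeE (tr_two_chunk_mx _ _ _ _ _ _) (two_chunk_weighting kn nz)).
rewrite big_split_ord /=.
under eq_bigr do rewrite col_mxEu mxE.
under [X in _ + X]eq_bigr do rewrite col_mxEd mxE.
rewrite !sumr_const !card_ord -mulrnDl -[LHS]mulr_natl -/A -/B -/C.
by clearbody A B C; field.
Qed.

(** * Small-scale asymptotics *)

Lemma cvg_id_at_right0 (R : realType) : t @[t --> (0 : R)^'+] --> (0 : R).
Proof. exact/cvg_at_right_filter/cvg_id. Qed.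

Lemma cvg_expRN_at_right0 (R : realType) (c : R) :
  expR (- (t * c)) @[t --> 0^'+] --> (1 : R).
Proof.
have h : - (t * c) @[t --> 0^'+] --> (0 : R).
  rewrite -[X in _ --> X]oppr0 -[X in _ --> - X](mul0r c).
  by apply: cvgN; apply: cvgMr_tmp; exact: cvg_id_at_right0.
by rewrite -[X in _ --> X]expR0; apply: (cvg_comp _ _ h); exact: continuous_expR.
Qed.

Lemma cvg_expRB1_div (R : realType) (c : R) :
  (expR (- (t * c)) - 1) / t @[t --> 0^'+] --> - c.
Proof.
have e1 := @cvg_expRN_at_right0 R c.
have slope : - c * expR (- (t * c)) / 1 @[t --> 0^'+] --> - c.
  rewrite -[X in _ --> X]mulr1; under eq_fun do rewrite divr1.
  exact: cvgMl_tmp.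
apply: (@lhopital_at_right R _ (fun t => - c * expR (- (t * c))) id (fun=> 1) 0 1).
- exact: ltr01.
- by move=> x _; apply: is_derive_eq; rewrite /GRing.scale /=; ring.
- by rewrite -[X in _ --> X](subrr (1 : R)); apply: cvgB => //; exact: cvg_cst.
- exact: cvg_id_at_right0.
- by move=> x _; exact: oner_neq0.
- exact: slope.
Qed.

(** Differentiating numerator and denominator reduces this to the first-order
    limit [cvg_expRB1_div] scaled by - c / 2. *)
Lemma cvg_expRB1D_div (R : realType) (c : R) :
  (expR (- (t * c)) - 1 + t * c) / t ^+ 2 @[t --> 0^'+] --> c ^+ 2 / 2.
Proof.
have e1 := @cvg_expRN_at_right0 R c.
have t0 := @cvg_id_at_right0 R.
have slope : (c - c * expR (- (t * c))) / (2 * t) @[t --> 0^'+] --> c ^+ 2 / 2.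
  rewrite -[X in _ --> X](_ : - (c / 2) * - c = _); last by field.
  apply: cvg_trans (cvgMl_tmp (@cvg_expRB1_div R c)).
  apply: near_eq_cvg; near=> t => /=.
  have t_neq0 : t != 0 by rewrite gt_eqF //; near: t; exact: nbhs_right_gt.
  by field.
apply: (@lhopital_at_right R _ (fun t => c - c * expR (- (t * c))) _
  (fun t => 2 * t) 0 1).
- exact: ltr01.
- by move=> x _; apply: is_derive_eq; rewrite /GRing.scale /=; ring.
- by move=> x _; apply: is_derive_eq; rewrite /GRing.scale /=; ring.
- rewrite -[X in _ --> X](_ : 1 - 1 + 0 * c = 0); last by ring.
  apply: cvgD; first by apply: cvgB => //; exact: cvg_cst.
  exact: cvgMr_tmp.
- rewrite -[X in _ --> X](mulr0 0); under eq_fun do rewrite expr2.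
  exact: cvgM.
- by move=> x; rewrite in_itv /= => /andP[x0 _]; rewrite mulf_neq0 ?gt_eqF.
- exact: slope.
Unshelve. all: by end_near. Qed.

(** Balance enters twice: it removes the terms of order t from the numerator, and
    it makes the slopes of A - C and B - C opposite to each other, so that their
    product contributes - mu^2 to the denominator. The last hypothesis
    says that the denominator is of order exactly t^2, whence the existence of a
    weighting for small t. *)
Lemma two_chunk_small_scale (R : realType) (n k : nat) (a b c d : R) :
    (k <= n)%N -> balanced n k a b c d ->
  let mu := (n%:R - 1) * a - (k%:R * c + (n%:R - k%:R) * d) in
  let sigma := (n%:R - 1) * (a ^+ 2 + b ^+ 2)
               - 2 * (k%:R * c ^+ 2 + (n%:R - k%:R) * d ^+ 2) in
  n%:R * sigma - 2 * mu ^+ 2 != 0 ->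
  (\forall t \near (0 : R)^'+, has_magnitude (t *: two_chunk_mx n k a b c d)) /\
  magnitude (t *: two_chunk_mx n k a b c d) @[t --> (0 : R)^'+] -->
    n%:R * sigma / (n%:R * sigma - 2 * mu ^+ 2).
Proof.
move=> kn bal mu sigma nz.
pose N : R := n%:R; pose K : R := k%:R.
rewrite /balanced -/N -/K in bal.
(* u and r are the remainders of exp (- t x), divided by t and t^2; p and h are
   the corresponding combinations for A - C or B - C and for A + B - 2 C. *)
pose u (x t : R) := (expR (- (t * x)) - 1) / t.
pose r (x t : R) := (expR (- (t * x)) - 1 + t * x) / t ^+ 2.
pose A t := chunk_sum n (t * a); pose B t := chunk_sum n (t * b).
pose C t := cross_sum n k (t * c) (t * d).
pose p (x t : R) := (N - 1) * u x t - (K * u c t + (N - K) * u d t).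
pose h t := (N - 1) * (r a t + r b t) - 2 * (K * r c t + (N - K) * r d t).
pose den t := C t * h t + p a t * p b t.
have cvg_u x : u x t @[t --> 0^'+] --> - x by exact: cvg_expRB1_div.
have cvg_r x : r x t @[t --> 0^'+] --> x ^+ 2 / 2 by exact: cvg_expRB1D_div.
have cvg_C : C t @[t --> 0^'+] --> N.
  rewrite -[X in _ --> X](_ : K * 1 + (N - K) * 1 = N); last by ring.
  by apply: cvgD; apply: cvgMl_tmp; exact: cvg_expRN_at_right0.
have cvg_p x : p x t @[t --> 0^'+] -->
    (N - 1) * - x - (K * - c + (N - K) * - d).
  by apply: cvgB; [|apply: cvgD]; exact: cvgMl_tmp.
have cvg_h : h t @[t --> 0^'+] --> sigma / 2.
  rewrite -[X in _ --> X](_ : (N - 1) * (a ^+ 2 / 2 + b ^+ 2 / 2)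
    - 2 * (K * (c ^+ 2 / 2) + (N - K) * (d ^+ 2 / 2)) = _); last first.
    by rewrite /sigma -/N -/K; field.
  apply: cvgB; apply: cvgMl_tmp; apply: cvgD => //; exact: cvgMl_tmp.
have cvg_den : den t @[t --> 0^'+] --> (N * sigma - 2 * mu ^+ 2) / 2.
  rewrite -[X in _ --> X](_ : N * (sigma / 2)
    + ((N - 1) * - a - (K * - c + (N - K) * - d))
      * ((N - 1) * - b - (K * - c + (N - K) * - d)) = _).
    by apply: cvgD; apply: cvgM.
  (* Balance turns the slope of B - C into mu. *)
  have -> : (N - 1) * - b = (N - 1) * a - 2 * (K * c + (N - K) * d).
    by rewrite bal; ring.
  by rewrite /mu -/N -/K; field.
have nz2 : (N * sigma - 2 * mu ^+ 2) / 2 != 0 by rewrite mulf_neq0.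
have den_neq0 := cvgr_neq0 _ cvg_den nz2.
have numE t : t != 0 -> A t + B t - 2 * C t = t ^+ 2 * h t.
  (* The two sides differ by t times the defect of balance. *)
  move=> t0; rewrite /A /B /C /chunk_sum /cross_sum /h /r -/N -/K.
  have defect : t * (2 * (K * c + (N - K) * d) - (N - 1) * (a + b)) = 0.
    by rewrite bal subrr mulr0.
  by rewrite -[LHS]subr0 -defect; field.
have pE x t : t != 0 -> chunk_sum n (t * x) - C t = t * p x t.
  by move=> t0; rewrite /C /chunk_sum /cross_sum /p /u -/N -/K; field.
have denE t : t != 0 -> A t * B t - C t ^+ 2 = t ^+ 2 * den t.
  move=> t0; transitivity (C t * (t ^+ 2 * h t) + (t * p a t) * (t * p b t)).
    by rewrite -numE // -!pE // -/(A t) -/(B t); ring.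
  by rewrite /den; ring.
have mag_defined : \forall t \near (0 : R)^'+, A t * B t - C t ^+ 2 != 0 /\
    N * (A t + B t - 2 * C t) / (A t * B t - C t ^+ 2) = N * h t / den t.
  near=> t.
  have t0 : t != 0 by rewrite gt_eqF //; near: t; exact: nbhs_right_gt.
  have dt0 : den t != 0 by near: t; exact: den_neq0.
  rewrite denE // numE //; split; first by rewrite mulf_neq0 ?expf_neq0.
  by field; rewrite dt0 t0.
split.
  apply: filterS mag_defined => t [ABC0 _]; rewrite scale_two_chunk_mx.
  eexists; exact: (two_chunk_weighting kn ABC0).
rewrite -[X in _ --> X](_ : N * (sigma / 2) / ((N * sigma - 2 * mu ^+ 2) / 2) = _).
  apply: cvg_trans (cvgM (cvgMl_tmp cvg_h) (cvgV nz2 cvg_den)).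
  apply: near_eq_cvg; apply: filterS mag_defined => t [ABC0 E].
  by rewrite scale_two_chunk_mx two_chunk_magnitude //= -E.
by field.
Unshelve. all: by end_near. Qed.

Theorem mainTheorem4 (R : realType) :
  let D : 'M[R]_(6 + 6) := two_chunk_mx 6 2 (7 / 3) (29 / 15) 3 (7 / 6) in
  [/\ distance_matrix D,
      balanced 6 2 (7 / 3 : R) (29 / 15) 3 (7 / 6),
      \forall t \near (0 : R)^'+, has_magnitude (t *: D),
      magnitude (t *: D) @[t --> (0 : R)^'+] --> (44 / 59 : R) &
      (44 / 59 : R) < 1].
Proof.
move=> D.
have bal : balanced 6 2 (7 / 3 : R) (29 / 15) 3 (7 / 6).
  by rewrite /balanced; lra.
have [|defined lim] := two_chunk_small_scale (isT : (2 <= 6)%N) bal.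
  by apply/eqP; lra.
split => //; last by lra.
  by apply: two_chunk_distance; rewrite ?ler_norml; lra.
by move: lim; congr (_ --> _); field.
Qed.
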